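(* Let $t,k\ge 2$, and consider a chordal $t$-coloring of the complete graph $K_n$ in which every edge has at least $k-1$ colors. Then there are sets $W_1,\dots,W_t\subseteq V(K_n)$ (possibly empty) such that each $W_i$ is a clique of color $i$ and $|W_1\cup\dots\cup W_t|\ge \frac{k-1}{k+1}n$.
   Context: A $t$-coloring of $K_n$ is a representation of its edge set as a union $E(G_1)\cup\dots\cup E(G_t)$ of edge sets of $t$ graphs $G_1,\dots,G_t$ on $V(K_n)$; an edge has color $i$ if it belongs to $G_i$, and may have several colors. A clique of color $i$ is a vertex set spanning a complete subgraph of $G_i$. The coloring is chordal if every $G_i$ is chordal (has no induced cycle of length at least $4$). *)

(* Defs.v *)
From HB Require Import structures.
From mathcomp Require Import all_boot all_order all_algebra.

Set Implicit Arguments.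
Unset Strict Implicit.
Unset Printing Implicit Defensive.

Record sgraph (T : finType) := SGraph {
  edge :> rel T;
  edge_sym : symmetric edge;
  edge_irr : irreflexive edge
}.

Definition clique (T : finType) (G : sgraph T) (W : {set T}) : Prop :=
  {in W &, forall x y, x != y -> G x y}.

(* [ordS] is the cyclic successor on ['I_m], so the vertices [c 0], ...,       *)
(* [c (m - 1)] are adjacent exactly when consecutive along the cycle.         *)
Definition induced_cycle (T : finType) (G : sgraph T) (m : nat)
    (c : 'I_m -> T) : Prop :=
  injective c /\
  forall i j : 'I_m, G (c i) (c j) = (j == ordS i) || (i == ordS j).

Definition chordal (T : finType) (G : sgraph T) : Prop :=
  forall (m : nat) (c : 'I_m -> T), 4 <= m -> ~ induced_cycle G c.

Definition colors (t n : nat) (G : 'I_t -> sgraph 'I_n) (x y : 'I_n) :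
    {set 'I_t} :=
  [set i | G i x y].

(* The edges of K_n are the pairs of distinct vertices; since each [G i] is   *)
(* irreflexive, the union of the edge sets is E(K_n) iff it covers them all.  *)
Definition coloring (t n : nat) (G : 'I_t -> sgraph 'I_n) : Prop :=
  forall x y : 'I_n, x != y -> exists i : 'I_t, G i x y.

Definition chordal_coloring (t n : nat) (G : 'I_t -> sgraph 'I_n) : Prop :=
  coloring G /\ forall i : 'I_t, chordal (G i).

(* Main.v *)
(** Choose cliques [W_i] covering as many vertices as possible, let [U] be the
    uncovered set, and let [b_i] be the number of vertices covered by [W_i]
    alone. By maximality a clique of color [i] inside [U] has at most [b_i]
    vertices, so eliminating simplicial vertices shows that [G_i] has at most
    [(b_i - 1) |U|] edges inside [U]. Every pair in [U] has [k - 1] colors,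
    hence [(k - 1) (|U| - 1) / 2 <= \sum_i (b_i - 1)], whereas
    [\sum_i b_i <= n - |U|]; together with [t >= k - 1] this gives
    [(k + 1) |U| <= 2 n]. *)
Require Import Defs.
From HB Require Import structures.
From mathcomp Require Import all_boot all_order all_algebra.
From mathcomp Require Import zify.
Set Implicit Arguments.
Unset Strict Implicit.
Unset Printing Implicit Defensive.
Import Order.TTheory GRing.Theory Num.Theory.
Local Open Scope ring_scope.

(** * Shortest paths with interior in a prescribed set *)

Lemma shortest_connecting_path (T : finType) (e : rel T) (C : {set T})
    (x y : T) (p0 : seq T) :
  path e x (rcons p0 y) -> all [in C] p0 ->
  exists p, [/\ path e x (rcons p y), all [in C] p &
    forall p', path e x (rcons p' y) -> all [in C] p' ->
      (size p <= size p')%N].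
Proof.
move=> xp0 Cp0.
(* Tuples of a fixed length form a finite type, so [Q] is decidable and has a least witness. *)
pose Q m := [exists p : m.-tuple T, path e x (rcons p y) && all [in C] p].
have QP p : path e x (rcons p y) -> all [in C] p -> Q (size p).
  by move=> xp Cp; apply/existsP; exists (in_tuple p); rewrite xp Cp.
have exQ : exists m, Q m by exists (size p0); apply: QP.
case: (ex_minnP exQ) => m /existsP[p /andP[xp Cp]].
move=> min_m; exists (tval p); split=> // p' xp' Cp'.
by rewrite size_tuple; apply: min_m; apply: QP.
Qed.

Section SimplicialVertices.

Variables (T : finType) (G : sgraph T).

Definition cliqueb (W : {set T}) : bool :=
  [forall x in W, forall y in W, (x != y) ==> G x y].

Lemma cliqueP W : reflect (clique G W) (cliqueb W).
Proof.
apply: (iffP forall_inP) => [cW x y xW yW neq_xy | cW x xW].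
  by move/forall_inP: (cW x xW) => /(_ y yW); rewrite neq_xy.
by apply/forall_inP=> y yW; apply/implyP; apply: cW.
Qed.

(** A chord would give a path with a shorter interior, and a repeated vertex would produce a
    chord. *)
Lemma minimal_path_induced (C : {set T}) (x y : T) (p : seq T) :
  x != y -> path G x (rcons p y) -> all [in C] p ->
  (forall p', path G x (rcons p' y) -> all [in C] p' ->
    (size p <= size p')%N) ->
  let q := x :: rcons p y in
  forall a b, (a < b < size q)%N ->
    nth x q a != nth x q b /\ G (nth x q a) (nth x q b) = (b == a.+1).
Proof.
move=> neq_xy xp Cp min_p q.
have size_q : size q = (size p).+2 by rewrite /= size_rcons.
have step a : (a.+1 < size q)%N -> G (nth x q a) (nth x q a.+1).
  by move=> lt_a; move/pathP: xp => /(_ x a); apply.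
have chordless a b : (a.+1 < b < size q)%N -> ~~ G (nth x q a) (nth x q b).
  case: b => [|b] // /andP[lt_ab lt_b]; apply/negP=> Gab.
  rewrite size_q in lt_b; have le_b : (b <= size p)%N by lia.
  (* Shortcut along the chord: position [b.+1] of [q] is entry [b] of [rcons p y], so [a < b] makes
     the new interior shorter. *)
  suff: (size p <= size (take a p ++ drop b p))%N.
    rewrite size_cat size_takel; last by lia.
    by rewrite size_drop; lia.
  apply: min_p; last first.
    by rewrite all_cat; apply/andP; split; apply/allP=> z;
       [move/mem_take | move/mem_drop]; apply: (allP Cp).
  have -> : rcons (take a p ++ drop b p) y
            = take a (rcons p y) ++ drop b (rcons p y).
    rewrite rcons_cat -drop_rcons //; congr (_ ++ _).
    by rewrite -cats1 take_cat; have -> : (a < size p)%N by lia.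
  have xs := xp; rewrite -(cat_take_drop b.+1 (rcons p y)) cat_path in xs.
  have sz : (b < size (rcons p y))%N by rewrite size_rcons.
  have sza : (a <= size (rcons p y))%N by rewrite size_rcons; lia.
  have last_take c : (c <= size (rcons p y))%N ->
      last x (take c (rcons p y)) = nth x q c.
    move=> le_c; rewrite (last_nth x) size_takel //.
    by rewrite /q; case: c le_c => [|c] le_c //=; rewrite nth_take.
  rewrite cat_path (drop_nth x) //= last_take // Gab /=.
  case/andP: xs => _; rewrite last_take //= => ->.
  rewrite -{1}(cat_take_drop a (rcons p y)) cat_path in xp.
  by case/andP: xp => ->.
move=> a b /andP[lt_ab lt_b]; split; last first.
  case: (eqVneq b a.+1) => [eq_b | neq_b]; first by rewrite eq_b step -?eq_b.
  by apply/negbTE/chordless; lia.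
(* If positions [a < b] coincide, the edge leaving [b] is a chord from [a]. When [b] is the end of
   the path, the edge entering [a] is a chord to [b], unless [a = 0], which would force [x = y]. *)
apply/eqP=> eq_ab.
have [lt_b1 | ge_b1] := ltnP b.+1 (size q).
  have := @chordless a b.+1; rewrite lt_b1 eq_ab step // andbT.
  by move=> /(_ lt_ab).
case: a lt_ab eq_ab => [|a] lt_ab eq_ab.
  have eq_b : b = (size p).+1 by lia.
  move: eq_ab; rewrite eq_b /= nth_rcons ltnn eqxx => /eqP.
  by rewrite (negPf neq_xy).
have := @chordless a b; rewrite -eq_ab lt_ab lt_b step ?(ltn_trans lt_ab) //.
by move=> /(_ isT).
Qed.

(** * Simplicial vertices of chordal graphs and the resulting edge bound *)

Hypothesis chordalG : chordal G.

(* A shortest path from [x] to [y] through [C], closed up by [v], would be an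
   induced cycle. *)
Lemma chordal_common_neighbors_adjacent (C : {set T}) (v x y : T)
    (p0 : seq T) :
  v \notin C -> {in C, forall z, ~~ G v z} -> G v x -> G v y -> x != y ->
  path G x (rcons p0 y) -> all [in C] p0 -> G x y.
Proof.
move=> vC nbC vx vy neq_xy xp0 Cp0; apply/negPn/negP=> nxy.
have [p [xp Cp min_p]] := shortest_connecting_path xp0 Cp0.
have := minimal_path_induced neq_xy xp Cp min_p.
(* Non-adjacency of [x] and [y] forces an interior vertex, so the cycle, of length [size p + 3], has
   length at least 4. *)
have p_gt0 : (0 < size p)%N.
  by case: p xp {Cp min_p} => //=; rewrite andbT (negPf nxy).
set q := x :: rcons p y => indq.
have size_q : size q = (size p).+2 by rewrite /= size_rcons.
have q_inner a : (0 < a <= size p)%N -> nth x q a \in C.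
  case: a => // a /= lt_a; rewrite nth_rcons lt_a.
  by apply: (allP Cp); rewrite mem_nth.
have q_last : nth x q (size p).+1 = y by rewrite /= nth_rcons ltnn eqxx.
have Gvq a : (a < size q)%N ->
    v != nth x q a /\ G v (nth x q a) = (a == 0%N) || (a == (size p).+1).
  move=> lt_a; case: (posnP a) => [-> | a_gt0].
    by split=> //=; apply: contraTneq vx => ->; rewrite edge_irr.
  have [a_le | a_gt] := leqP a (size p).
    have Ca : nth x q a \in C by apply: q_inner; rewrite a_gt0.
    split; first by apply: contraNneq vC => ->.
    by rewrite (negPf (nbC _ Ca)); lia.
  have -> : a = (size p).+1 by lia.
  rewrite q_last eqxx vy orbT; split=> //.
  by apply: contraTneq vy => ->; rewrite edge_irr.
(* [v] takes index 0, so index [a.+1] of the cycle is position [a] of the path. *)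
pose c (i : 'I_(size p).+3) := nth x (v :: q) i.
have indc (i j : 'I_(size p).+3) : (i < j)%N ->
    c i != c j /\ G (c i) (c j) = (j == ordS i) || (i == ordS j).
  move=> lt_ij; rewrite /c -!val_eqE /=.
  have lt_j := ltn_ord j; rewrite (modn_small (_ : i.+1 < _)%N); last by lia.
  (* For [i < j], the successor of [j] can be [i] only by wrapping around from the last index to
     0. *)
  have -> : (nat_of_ord i == j.+1 %% (size p).+3)%N
            = (nat_of_ord i == 0%N) && (nat_of_ord j == (size p).+2).
    have [lt_j1 | ge_j1] := ltnP j.+1 (size p).+3.
      by rewrite modn_small //; lia.
    have -> : j.+1 = (size p).+3 by lia.
    by rewrite modnn; lia.
  case: (nat_of_ord j) lt_ij lt_j => [|b] // lt_ib lt_b.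
  case: (nat_of_ord i) lt_ib => [|a] lt_ab.
    by have [] := Gvq b; rewrite ?size_q //= => -> ->; rewrite !eqSS.
  have [] := indq a b; first by rewrite size_q; lia.
  by move=> neq_ab adj; split=> //; rewrite [LHS]adj !eqSS orbF.
apply: (@chordalG _ c); first by lia.
split=> [i j eq_c | i j].
  case: (ltngtP i j) => [/indc[] | /indc[] | /val_inj //].
    by rewrite eq_c eqxx.
  by rewrite eq_c eqxx.
case: (ltngtP i j) => [/indc[] // | /indc[_] | /val_inj->].
  by rewrite edge_sym orbC.
rewrite edge_irr orbb -val_eqE /=; have lt_j := ltn_ord j.
have [lt_j1 | ge_j1] := ltnP j.+1 (size p).+3.
  by rewrite modn_small //; lia.
have -> : j.+1 = (size p).+3 by lia.
by rewrite modnn; lia.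
Qed.

Definition simplicial (V : {set T}) (u : T) : Prop :=
  clique G [set a in V | G u a].

(* Let [C] be a component of the non-neighbours of [v] and [S] its boundary.
   [S] is a clique of neighbours of [v], and a simplicial vertex of [C :|: S]
   lying in [C] is simplicial in [V]; induction applies to [C :|: S], which
   misses [v]. *)
Lemma simplicial_nonneighbor (V : {set T}) (v z : T) :
  v \in V -> z \in V -> z != v -> ~~ G v z ->
  exists u, [/\ u \in V, u != v, ~~ G v u & simplicial V u].
Proof.
have [m] := ubnP #|V|; elim: m V v z => // m IH V v z ltVm vV zV neq_zv nvz.
pose far := [set a in V | (a != v) && ~~ G v a].
pose e := [rel a b | [&& G a b, a \in far & b \in far]].
have e_sym : symmetric e.
  by move=> a b; rewrite /= edge_sym [(a \in _) && _]andbC.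
pose C := [set a | connect e z a].
have zfar : z \in far by rewrite inE zV neq_zv.
have Cfar a : a \in C -> a \in far.
  rewrite inE => /connectP[p zp ->] {a}.
  elim/last_ind: p zp => //= p a _; rewrite rcons_path last_rcons.
  by case/andP=> _ /and3P[].
have Cclosed a b : a \in C -> b \in far -> G a b -> b \in C.
  move=> aC bfar ab; have afar := Cfar a aC; move: aC; rewrite !inE.
  move/connect_trans; apply; apply: connect1.
  by rewrite /= ab afar bfar.
have vC : v \notin C by apply/negP=> /Cfar; rewrite inE eqxx andbF.
have nvC : {in C, forall a, ~~ G v a}.
  by move=> a /Cfar; rewrite inE => /and3P[].
pose S := [set a in V :\: C | [exists b in C, G a b]].
have Sv a : a \in S -> G v a.
  rewrite !inE -andbA => /and3P[aC aV /exists_inP[b bC ab]].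
  apply/negPn/negP=> nva; case/negP: aC.
  suff: a \in C by rewrite inE.
  apply: (Cclosed b) => //; last by rewrite edge_sym.
  rewrite inE aV nva andbT /=; apply: contraTneq ab => ->.
  exact: nvC.
(* Any two vertices of [S] are neighbours of [v] joined by a path whose interior lies in the
   connected set [C]. *)
have cliqueS : clique G S.
  move=> x y xS yS neq_xy.
  have [x' x'C xx'] : exists2 b, b \in C & G x b.
    by move: xS; rewrite inE => /andP[_ /exists_inP].
  have [y' y'C yy'] : exists2 b, b \in C & G y b.
    by move: yS; rewrite inE => /andP[_ /exists_inP].
  have : connect e x' y'.
    move: x'C y'C; rewrite !inE => zx' zy'.
    by apply: connect_trans zy'; rewrite (sym_connect_sym e_sym).
  case/connectP=> p x'p def_y'.
  apply: (@chordal_common_neighbors_adjacent C v x y (x' :: p)) => //.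
  - exact: Sv.
  - exact: Sv.
  - rewrite /= xx' /= rcons_path -def_y' edge_sym yy' andbT.
    by apply: sub_path x'p => a b /and3P[].
  - rewrite /= x'C /=; apply/allP=> a ap; rewrite inE.
    move: x'C; rewrite inE => /connect_trans; apply.
    by apply: (path_connect x'p); rewrite inE ap orbT.
pose V' := C :|: S.
have CV : C \subset V by apply/subsetP=> a /Cfar; rewrite inE => /andP[].
have V'V : V' \subset V.
  by rewrite subUset CV; apply/subsetP=> a; rewrite !inE => /andP[/andP[]].
have vV' : v \notin V'.
  by rewrite inE negb_or vC; apply/negP=> /Sv; rewrite edge_irr.
have ltV' : (#|V'| < m)%N.
  rewrite -ltnS; apply: leq_trans ltVm; rewrite ltnS.
  by apply: proper_card; apply/properP; split=> //; exists v.
suff [u uC simp_u] : exists2 u, u \in C & simplicial V' u.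
  have := Cfar u uC; rewrite inE => /and3P[uV neq_uv nvu].
  exists u; split=> // a b; rewrite !inE.
  (* A neighbour in [V] of a vertex of [C] is in [C] or on its boundary, so passing from [V'] to [V]
     adds no neighbour of [u]. *)
  have nbV' d : d \in V -> G u d -> d \in V'.
    move=> dV ud; rewrite in_setU [d \in S]inE in_setD dV andbT.
    case: (d \in C) => //=; apply/exists_inP; exists u => //.
    by rewrite edge_sym.
  case/andP=> aV ua /andP[bV ub]; apply: simp_u; rewrite inE ?ua ?ub andbT;
  exact: nbV'.
(* If some [w] in [S] misses a vertex of [V'], induction at [w] yields a simplicial [u] not adjacent
   to [w]; since [S] is a clique, [u] lies in [C]. *)
have [/exists_inP[w wS /exists_inP[d dV' /andP[neq_dw nwd]]] | S_full] :=
    boolP [exists w in S, exists d in V', (d != w) && ~~ G w d].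
  have wV' : w \in V' by rewrite inE wS orbT.
  have [u [uV' neq_uw nwu simp_u]] := IH V' w d ltV' wV' dV' neq_dw nwd.
  exists u => //; move: uV'; rewrite in_setU => /orP[] // uS.
  by case/negP: nwu; apply: cliqueS; rewrite // eq_sym.
have S_adj w d : w \in S -> d \in V' -> d != w -> G w d.
  move=> wS dV' neq_dw; apply/negPn/negP=> nwd; case/negP: S_full.
  by apply/exists_inP; exists w => //; apply/exists_inP; exists d => //;
     rewrite neq_dw.
(* Now [S] is joined to all of [V']. If [C] is a clique, so is [V'], and [z] serves; otherwise
   induction at a [w] in [C] yields a [u] not adjacent to [w], hence outside [S]. *)
have [/cliqueP cliqueC | ] := boolP (cliqueb C).
  exists z; first by rewrite inE.
  move=> a b; rewrite inE => /andP[aV' _]; rewrite inE => /andP[bV' _] neq_ab.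
  case/setUP: (aV') => [aC | aS]; last by apply: S_adj; rewrite // eq_sym.
  case/setUP: (bV') => [bC | bS]; first exact: cliqueC.
  by rewrite edge_sym; apply: S_adj.
case/forall_inPn=> w wC /forall_inPn[d dC]; rewrite negb_imply => /andP[neq_wd nwd].
have wV' : w \in V' by rewrite inE wC.
have dV' : d \in V' by rewrite inE dC.
rewrite eq_sym in neq_wd.
have [u [uV' neq_uw nwu simp_u]] := IH V' w d ltV' wV' dV' neq_wd nwd.
exists u => //; move: uV'; rewrite in_setU => /orP[] // uS.
by case/negP: nwu; rewrite edge_sym S_adj // eq_sym.
Qed.

Lemma exists_simplicial (V : {set T}) :
  V != set0 -> exists2 u, u \in V & simplicial V u.
Proof.
case/set0Pn=> v vV; have [/cliqueP cliqueV | ] := boolP (cliqueb V).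
  exists v => // a b; rewrite !inE => /andP[aV _] /andP[bV _].
  exact: cliqueV.
case/forall_inPn=> w wV /forall_inPn[d dV]; rewrite negb_imply eq_sym => /andP[].
move=> neq_dw nwd; have [u [uV _ _ simp_u]] := simplicial_nonneighbor wV dV neq_dw nwd.
by exists u.
Qed.

(* The left-hand side counts ordered pairs, hence the factor 2. *)
Lemma chordal_edges_bound (V : {set T}) (w : nat) :
  (forall K : {set T}, K \subset V -> clique G K -> (#|K| <= w.+1)%N) ->
  (\sum_(x in V) \sum_(y in V) G x y <= 2 * w * #|V|)%N.
Proof.
have [m] := ubnP #|V|; elim: m V => // m IH V ltVm cliqueV.
have [-> | /exists_simplicial[u uV simp_u]] := eqVneq V set0.
  by rewrite big_set0.
have cardV := cardsD1 u V; rewrite uV in cardV.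
have {}IH : (\sum_(x in V :\ u) \sum_(y in V :\ u) G x y
             <= 2 * w * #|V :\ u|)%N.
  apply: IH => [|K sKV]; first by lia.
  by apply: cliqueV; apply: subset_trans sKV (subD1set _ _).
(* A simplicial vertex together with its neighbours is a clique, of size at most [w.+1]. *)
have deg_u : (\sum_(y in V :\ u) G u y <= w)%N.
  have -> : (\sum_(y in V :\ u) G u y = #|[set a in V | G u a]|)%N.
    rewrite -big_mkcondr -sum1_card; apply: eq_bigl => a.
    rewrite !inE; case: (a =P u) => //= ->.
    by rewrite edge_irr andbF.
  rewrite -ltnS; set N := [set a in V | G u a].
  have uN : u \notin N by rewrite inE edge_irr andbF.
  have -> : #|N|.+1 = #|u |: N| by rewrite cardsU1 uN.
  apply: cliqueV.
    by rewrite subUset sub1set uV; apply/subsetP=> a; rewrite inE => /andP[].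
  have uN_adj a : a \in N -> G u a by rewrite inE => /andP[].
  move=> a b /setU1P[-> | aN] /setU1P[-> | bN] //.
  - by rewrite eqxx.
  - by move=> _; apply: uN_adj.
  - by move=> _; rewrite edge_sym; apply: uN_adj.
  - exact: simp_u.
rewrite (big_setD1 u) //= (big_setD1 u) //= edge_irr add0n.
(* Deleting [u] removes its degree twice, once as first and once as second entry of an ordered
   pair. *)
have -> : (\sum_(x in V :\ u) \sum_(y in V) G x y
           = \sum_(y in V :\ u) G u y
             + \sum_(x in V :\ u) \sum_(y in V :\ u) G x y)%N.
  rewrite -big_split; apply: eq_bigr => x _.
  by rewrite (big_setD1 u) //= edge_sym.
nia.
Qed.

End SimplicialVertices.

(** * Clique families covering the most vertices *)

(** The private parts are disjoint: a vertex of [W j] is private to no index other than [j]. *)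
Lemma sum_private_le (I T : finType) (W : I -> {set T}) :
  (\sum_i #|\bigcup_j W j :\: \bigcup_(j | j != i) W j|
    <= #|\bigcup_j W j|)%N.
Proof.
set cov := \bigcup_j W j.
have card_private i : (#|cov :\: \bigcup_(j | j != i) W j|
    = \sum_(x in cov) (x \notin \bigcup_(j | j != i) W j))%N.
  by rewrite -big_mkcondr -sum1_card; apply: eq_bigl => x; rewrite inE andbC.
rewrite (eq_bigr _ (fun i _ => card_private i)) exchange_big /= -sum1_card.
apply: leq_sum => x /bigcupP[j _ xj].
rewrite [leqLHS](bigD1 j) //= [X in (_ + X)%N]big1 ?addn0 => [|i neq_ij]; first exact: leq_b1.
suff -> : x \in \bigcup_(l | l != i) W l by [].
by apply/bigcupP; exists j; rewrite // eq_sym.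
Qed.

(** Exchange argument: replacing [W i] by [K] loses only the vertices private to [W i] and gains all
    of [K], so maximality bounds the gain by the loss. *)
Lemma maximum_clique_cover (I T : finType) (G : I -> sgraph T) :
  exists W : I -> {set T}, (forall i, clique (G i) (W i)) /\
    forall i (K : {set T}), K \subset ~: (\bigcup_j W j) -> clique (G i) K ->
      (#|K| <= #|\bigcup_j W j :\: \bigcup_(j | j != i) W j|)%N.
Proof.
pose P (W : {ffun I -> {set T}}) := [forall i, cliqueb (G i) (W i)].
have P0 : P [ffun=> set0].
  by apply/forallP=> i; apply/cliqueP=> x y; rewrite ffunE inE.
case: (arg_maxnP (fun W : {ffun I -> {set T}} => #|\bigcup_i W i|) P0).
move=> W /forallP PW maxW; exists W; split=> [i | i K sKU cliqueK].
  exact/cliqueP.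
pose W' := [ffun j => if j == i then K else W j].
have PW' : P W'.
  by apply/forallP=> j; rewrite ffunE; case: eqP => [-> | _] //; apply/cliqueP.
have := maxW W' PW'; set A := \bigcup_(j | j != i) W j.
have -> : \bigcup_j W' j = K :|: A.
  rewrite (bigD1 i) //= ffunE eqxx; congr (_ :|: _).
  by apply: eq_bigr => j /negPf neq_ji; rewrite ffunE neq_ji.
have sAcov : A \subset \bigcup_j W j.
  by apply/bigcupsP=> j _; apply: bigcup_sup.
have KA0 : K :&: A = set0.
  apply/eqP; rewrite setI_eq0; apply: disjointWr sAcov _.
  by rewrite disjoints_subset.
rewrite cardsU KA0 cards0 subn0 cardsD (setIidPr sAcov).
have := subset_leq_card sAcov; rewrite /=; lia.
Qed.

(** * Counting colored pairs among the uncovered vertices *)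

(** Here [k] stands for the theorem's [k - 1]. Counting colored ordered pairs in [U] in two ways and
    cancelling [#|U|] gives [k * (#|U| - 1) <= 2 * \sum_i (b i - 1)]; then [k <= t] absorbs the
    subtracted ones. *)
Lemma uncovered_bound (t k : nat) (T : finType) (G : 'I_t -> sgraph T)
    (U : {set T}) (b : 'I_t -> nat) :
  (forall i, chordal (G i)) -> (k <= t)%N -> U != set0 ->
  (forall x y, x != y -> (k <= #|[set i | G i x y]|)%N) ->
  (forall i (K : {set T}), K \subset U -> clique (G i) K ->
    (#|K| <= b i)%N) ->
  (k * #|U| <= 2 * \sum_i b i)%N.
Proof.
move=> chG le_kt U0 hcol hb.
have U_gt0 : (0 < #|U|)%N by rewrite card_gt0.
(* A single vertex is a clique of every color; positivity makes [(b i).-1] a true subtraction. *)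
have b_gt0 i : (0 < b i)%N.
  case/set0Pn: U0 => x xU; rewrite -(cards1 x); apply: hb.
    by rewrite sub1set.
  by move=> y z /set1P-> /set1P->; rewrite eqxx.
have upper : (\sum_i \sum_(x in U) \sum_(y in U) G i x y
              <= \sum_i 2 * (b i).-1 * #|U|)%N.
  apply: leq_sum => i _; apply: chordal_edges_bound => // K sKU cliqueK.
  by rewrite prednK // hb.
have lower : (#|U| * (#|U|.-1 * k)
              <= \sum_i \sum_(x in U) \sum_(y in U) G i x y)%N.
  rewrite exchange_big /= -sum_nat_const; apply: leq_sum => x xU.
  rewrite exchange_big /= (big_setD1 x) //=.
  apply: leq_trans (leq_addl _ _).
  have -> : #|U|.-1 = #|U :\ x| by rewrite (cardsD1 x U) xU.
  rewrite -sum_nat_const; apply: leq_sum => y; rewrite !inE => /andP[neq_yx _].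
  apply: leq_trans (hcol x y _) _; first by rewrite eq_sym.
  by rewrite -sum1dep_card big_mkcond.
have sum_b : (\sum_i b i = \sum_i (b i).-1 + t)%N.
  rewrite -[X in (_ + X)%N]card_ord -sum1_card -big_split /=.
  by apply: eq_bigr => i _; rewrite addn1 prednK.
move: upper; rewrite -big_distrl -big_distrr /= => upper.
have := leq_trans lower upper; rewrite [X in (_ <= X)%N]mulnC leq_pmul2l //.
case: #|U| U_gt0 => // u _ /=; rewrite sum_b mulnS [(k * u)%N]mulnC.
by move: (\sum_i _)%N => s; lia.
Qed.

Theorem theorem2p1 (t k n : nat) (ht : (2 <= t)%N) (hk : (2 <= k)%N)
    (G : 'I_t -> sgraph 'I_n) (hG : chordal_coloring G)
    (hcol : forall x y : 'I_n, x != y -> (k - 1 <= #|colors G x y|)%N) :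
  exists W : 'I_t -> {set 'I_n},
    (forall i : 'I_t, clique (G i) (W i)) /\
    (k%:R - 1) / (k%:R + 1) * n%:R <= #|\bigcup_(i < t) W i|%:R :> rat.
Proof.
have [W [cliqueW maxW]] := maximum_clique_cover G.
exists W; split=> //; set cov := \bigcup_i W i in maxW *.
have private := sum_private_le W; rewrite -/cov in private.
have cardU := cardsC cov; rewrite card_ord in cardU.
suff main : ((k - 1) * #|~: cov| <= 2 * #|cov|)%N.
  (* Substitute [n - #|cov|] for the size of the complement and use [(k - 1) + 2 = k + 1]. *)
  have : ((k - 1) * n <= #|cov| * (k + 1))%N by nia.
  rewrite -(ler_nat rat) !natrM natrB 1?ltnW // natrD => le_main.
  by rewrite mulrAC ler_pdivrMr // natr1 ltr0n.
have [-> | U0] := eqVneq (~: cov) set0; first by rewrite cards0 muln0.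
have [le_kt | lt_tk] := leqP (k - 1) t.
  apply: leq_trans (uncovered_bound hG.2 le_kt U0 hcol maxW) _.
  by rewrite leq_pmul2l.
(* With [t < k - 1] no edge can carry enough colors, so there is no edge at all. *)
have n_le1 : (n <= 1)%N.
  rewrite leqNgt; apply/negP=> n_gt1.
  have := hcol (Ordinal (ltnW n_gt1)) (Ordinal n_gt1) isT.
  by move/leq_trans/(_ (max_card _)); rewrite card_ord leqNgt lt_tk.
have b_gt0 (i : 'I_t) : (0 < #|cov :\: \bigcup_(j | j != i) W j|)%N.
  case/set0Pn: U0 => x xU; rewrite -(cards1 x); apply: maxW.
    by rewrite sub1set.
  by move=> y z /set1P-> /set1P->; rewrite eqxx.
(* An uncovered vertex forces a private vertex for every color, so [t <= #|cov|], contradicting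
   [n <= 1] and [2 <= t]. *)
have : (\sum_(i < t) 1 <= #|cov|)%N.
  by apply: leq_trans private; apply: leq_sum => i _; apply: b_gt0.
by rewrite sum1_card card_ord; move: U0; rewrite -card_gt0; lia.
Qed.
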